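(* Let $\mathcal{T}$ be an $R_0$-monochromatic 2-string tangle with unlinking (or rational splitting) closure tangle $\left[\frac pq\right]$. Then $\mathcal{T}$ has coloring fraction $\dfrac{-p}{q}$.
   Context: A 2-string tangle is a pair $(B,\sigma)$, $B$ a 3-ball and $\sigma$ two disjoint properly embedded arcs (no closed components), whose four ends are fixed points $NW,NE,SW,SE$ on the boundary circle of the diagram disk. The sum $\mathcal{T}+\mathcal{T}'$ glues the east side of $\mathcal{T}$ to the west side of $\mathcal{T}'$ ($NE,SE$ of $\mathcal{T}$ to $NW,SW$ of $\mathcal{T}'$); the product $\mathcal{T}*\mathcal{T}'$ glues the south side of $\mathcal{T}$ to the north side of $\mathcal{T}'$. The numerator closure $N(\mathcal{T})$ joins $NE$ to $NW$ and $SE$ to $SW$ by unknotted arcs. Rational tangles: $[0]$ is the pair of horizontal arcs ($NW$–$NE$, $SW$–$SE$), $[\infty]=[\frac10]$ the pair of vertical arcs, $[1]$ the one-crossing tangle whose overcrossing arc joins $NW$ to $SE$, $[-1]$ its mirror image. A rational tangle is one obtained from $[0]$ or $[\infty]$ by successive sums and products with $[\pm1]$; its fraction $F\in\mathbb{Q}\cup\{\infty\}$ is determined by $F([0])=0$, $F([\infty])=\infty$, $F(\mathcal{R}+[\pm1])=F(\mathcal{R})\pm1$, $1/F(\mathcal{R}*[\pm1])=1/F(\mathcal{R})\pm1$, and $[\frac pq]$ ($p,q$ coprime) is the rational tangle with fraction $p/q$, unique up to isotopy of $B$ fixing $\partial B$. An unlinking (resp. splitting) closure tangle of $\mathcal{T}$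 is a 2-string tangle $\mathcal{U}$ with $N(\mathcal{T}+\mathcal{U})$ the two-component unlink (resp. a split link); it is a rational splitting closure tangle if it is moreover rational. An $R_0$-coloring of a diagram of a tangle or link is a labeling of its arcs by integers such that at each crossing, if the overarc has label $y$ and the two underarcs have labels $x,z$, then $x+z=2y$ (coloring by the quandle $R_0=(\mathbb{Z},\diamond)$, $x\diamond y=2y-x$). It is trivial if all labels coincide. A coloring of a tangle is a $c$-coloring if all boundary arcs have the same label, and a $d$-coloring otherwise. A tangle is $R_0$-monochromatic if each of its $R_0$ $c$-colorings is trivial. If $a,b,c,d$ are the labels at $NW,NE,SW,SE$ of an $R_0$ $d$-coloring (they satisfy $a+d=b+c$, so $b-a$ and $b-d$ are not both $0$), its coloring fraction is $\frac{b-a}{b-d}\in\mathbb{Q}\cup\{\infty\}$ (with $\pm\infty$ identified). A tangle has coloring fraction $r$ if it has an $R_0$ $d$-coloring with coloring fraction $r$. *)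

(* Defs.v *)
From HB Require Import structures.
From Stdlib Require Import Relations.
From mathcomp Require Import all_boot all_order all_algebra.

Set Implicit Arguments.
Unset Strict Implicit.
Unset Printing Implicit Defensive.

Import GRing.Theory.

(* Unoriented tangle and link diagrams are taken in Morse position with
   respect to the height function of the page: a diagram is cut by horizontal
   lines into slices, each containing a single elementary piece, and is listed
   from top to bottom.  The slice (k, i) has i vertical strands to the left of
   the piece k.  Up to planar isotopy every diagram is of this form. *)

(* Cap is a local maximum (it creates two strands), Cup a local minimum (it
   joins two strands).  The overarc of Cross true goes from upper left to lower
   right, that of Cross false from upper right to lower left. *)
Inductive piece := Cap | Cup | Cross of bool.

Definition arity_in (k : piece) : nat := if k is Cap then 0 else 2.
Definition arity_out (k : piece) : nat := if k is Cup then 0 else 2.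

Definition slice := (piece * nat)%type.
Definition diagram := seq slice.

Definition next_width (m : nat) (s : slice) : nat :=
  m - arity_in s.1 + arity_out s.1.

(* wf m n D : D is a diagram with m upper and n lower ends. *)
Fixpoint wf (m n : nat) (D : diagram) : bool :=
  if D is s :: D' then
    (s.2 + arity_in s.1 <= m) && wf (next_width m s) n D'
  else m == n.

(* The number of strands met by the horizontal line below the first t slices
   of a diagram with m upper ends. *)
Definition width (m : nat) (D : diagram) (t : nat) : nat :=
  foldl next_width m (take t D).

(* The generating moves of Freyd-Yetter and Turaev for isotopy rel boundary of
   unoriented tangles.  The first five are planar isotopies: interchanging the
   heights of two distant pieces, straightening a zigzag, and sliding a strand
   across a maximum or minimum.  The others are the Reidemeister moves; those
   R1, R2 and R3 moves that are not listed follow from these. *)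
Inductive move : diagram -> diagram -> Prop :=
| exchange k k' i j :
    move [:: (k, i); (k', i + arity_out k + j)]
         [:: (k', i + arity_in k + j); (k, i)]
| zigzag_left i : move [:: (Cap, i); (Cup, i.+1)] [::]
| zigzag_right i : move [:: (Cap, i.+1); (Cup, i)] [::]
| slide_cap b i :
    move [:: (Cap, i); (Cross b, i.+1)] [:: (Cap, i.+1); (Cross (~~ b), i)]
| slide_cup b i :
    move [:: (Cross b, i); (Cup, i.+1)] [:: (Cross (~~ b), i.+1); (Cup, i)]
| R1_cap b i : move [:: (Cap, i); (Cross b, i)] [:: (Cap, i)]
| R1_cup b i : move [:: (Cross b, i); (Cup, i)] [:: (Cup, i)]
| R2 b i : move [:: (Cross b, i); (Cross (~~ b), i)] [::]
| R3 b i :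
    move [:: (Cross b, i); (Cross b, i.+1); (Cross b, i)]
         [:: (Cross b, i.+1); (Cross b, i); (Cross b, i.+1)].

Inductive step (m n : nat) : diagram -> diagram -> Prop :=
| Step D1 D2 L R : move L R ->
    wf m n (D1 ++ L ++ D2) -> wf m n (D1 ++ R ++ D2) ->
    step m n (D1 ++ L ++ D2) (D1 ++ R ++ D2).

Definition isotopic (m n : nat) : diagram -> diagram -> Prop :=
  clos_refl_sym_trans diagram (step m n).

(* The pair (t, j) is the point where the horizontal line below the first t
   slices meets its strand number j; adjacent points bound a piece of strand
   lying in one slice. *)
Inductive adjacent (D : diagram) : nat * nat -> nat * nat -> Prop :=
| adj_left t k i j : onth D t = Some (k, i) -> j < i ->
    adjacent D (t, j) (t.+1, j)
| adj_right t k i j : onth D t = Some (k, i) ->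
    adjacent D (t, i + arity_in k + j) (t.+1, i + arity_out k + j)
| adj_cap t i : onth D t = Some (Cap, i) ->
    adjacent D (t.+1, i) (t.+1, i.+1)
| adj_cup t i : onth D t = Some (Cup, i) ->
    adjacent D (t, i) (t, i.+1)
| adj_cross_down t b i : onth D t = Some (Cross b, i) ->
    adjacent D (t, i) (t.+1, i.+1)
| adj_cross_up t b i : onth D t = Some (Cross b, i) ->
    adjacent D (t, i.+1) (t.+1, i).

Definition connected (D : diagram) : nat * nat -> nat * nat -> Prop :=
  clos_refl_sym_trans (nat * nat) (adjacent D).

Definition no_closed_component (m n : nat) (D : diagram) : Prop :=
  forall t j, t <= size D -> j < width m D t ->
    (exists2 j', j' < m & connected D (t, j) (0, j')) \/
    (exists2 j', j' < n & connected D (t, j) (size D, j')).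

(* NW, NE are the upper ends and SW, SE the lower ends.  Having four ends and
   no closed component, the underlying 1-manifold consists of two arcs. *)
Definition two_string_tangle (T : diagram) : Prop :=
  wf 2 2 T /\ no_closed_component 2 2 T.

Definition shift (m : nat) (D : diagram) : diagram :=
  [seq (s.1, m + s.2) | s <- D].

(* T and U are placed side by side; the Cap joins NE of T to NW of U and the
   Cup joins SE of T to SW of U. *)
Definition tangle_sum (T U : diagram) : diagram :=
  (Cap, 1) :: T ++ shift 2 U ++ [:: (Cup, 1)].

Definition tangle_prod (T U : diagram) : diagram := T ++ U.

Definition numerator (T : diagram) : diagram :=
  (Cap, 0) :: T ++ [:: (Cup, 0)].

Definition unlink2 : diagram :=
  [:: (Cap, 0); (Cup, 0); (Cap, 0); (Cup, 0)].

(* In D1 ++ D2 a horizontal line separates D1 from D2. *)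
Definition split_link (D : diagram) : Prop :=
  exists D1 D2 : diagram,
    [/\ wf 0 0 D1 /\ D1 <> [::], wf 0 0 D2 /\ D2 <> [::]
      & isotopic 0 0 D (D1 ++ D2)].

Definition tangle0 : diagram := [:: (Cup, 0); (Cap, 0)].
Definition tangle_infty : diagram := [::].
(* [1] is tangle_pm1 true and [-1] is tangle_pm1 false. *)
Definition tangle_pm1 (b : bool) : diagram := [:: (Cross b, 0)].

Local Open Scope ring_scope.

(* None is the point at infinity. *)
Definition ratinf := option rat.

Definition extfrac (p q : int) : ratinf :=
  if q == 0 then None else Some (p%:Q / q%:Q).

Definition ratinf_add (f : ratinf) (e : rat) : ratinf :=
  omap (fun r => r + e) f.

Definition ratinf_inv (f : ratinf) : ratinf :=
  if f is Some r then (if r == 0 then None else Some r^-1) else Some 0.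

Definition pm1 (b : bool) : rat := if b then 1 else - 1.

Inductive rational_fraction : diagram -> ratinf -> Prop :=
| rational0 : rational_fraction tangle0 (Some 0)
| rational_infty : rational_fraction tangle_infty None
| rational_sum b T f : rational_fraction T f ->
    rational_fraction (tangle_sum T (tangle_pm1 b)) (ratinf_add f (pm1 b))
| rational_prod b T f : rational_fraction T f ->
    rational_fraction (tangle_prod T (tangle_pm1 b))
      (ratinf_inv (ratinf_add (ratinf_inv f) (pm1 b)))
| rational_isotopic T T' f : rational_fraction T f ->
    isotopic 2 2 T T' -> rational_fraction T' f.

Definition rational (T : diagram) : Prop :=
  exists f, rational_fraction T f.

Definition unlinking_closure (T U : diagram) : Prop :=
  two_string_tangle U /\ isotopic 0 0 (numerator (tangle_sum T U)) unlink2.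

Definition splitting_closure (T U : diagram) : Prop :=
  two_string_tangle U /\ split_link (numerator (tangle_sum T U)).

Definition rational_splitting_closure (T U : diagram) : Prop :=
  splitting_closure T U /\ rational U.

(* The strands just above and just below a slice are labeled by lists of
   integers, read from left to right.  At a crossing the overarc has label y
   and the underarcs have labels x and z. *)
Inductive slice_coloring : slice -> seq int -> seq int -> Prop :=
| color_cap l r x :
    slice_coloring (Cap, size l) (l ++ r) (l ++ [:: x; x] ++ r)
| color_cup l r x :
    slice_coloring (Cup, size l) (l ++ [:: x; x] ++ r) (l ++ r)
| color_cross_true l r x y z : x + z = 2 * y ->
    slice_coloring (Cross true, size l)
      (l ++ [:: y; x] ++ r) (l ++ [:: z; y] ++ r)
| color_cross_false l r x y z : x + z = 2 * y ->
    slice_coloring (Cross false, size l)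
      (l ++ [:: x; y] ++ r) (l ++ [:: y; z] ++ r).

(* An R_0-coloring of D is given by the labels u of its upper ends and by the
   list C of the labels below its successive slices. *)
Fixpoint coloring (D : diagram) (u : seq int) (C : seq (seq int)) : Prop :=
  match D, C with
  | [::], [::] => True
  | s :: D', v :: C' => slice_coloring s u v /\ coloring D' v C'
  | _, _ => False
  end.

Record tangle_coloring (T : diagram) := TangleColoring {
  NW : int; NE : int; SW : int; SE : int;
  levels : seq (seq int);
  tangle_coloringP : coloring T [:: NW; NE] levels;
  south_labels : last [:: NW; NE] levels = [:: SW; SE] }.

Definition trivial_coloring (T : diagram) (C : tangle_coloring T) : Prop :=
  exists x : int, forall u, u \in [:: NW C; NE C] :: levels C ->
    forall y, y \in u -> y = x.

Definition c_coloring (T : diagram) (C : tangle_coloring T) : Prop :=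
  [/\ NW C = NE C, NW C = SW C & NW C = SE C].

Definition d_coloring (T : diagram) (C : tangle_coloring T) : Prop :=
  ~ c_coloring C.

Definition fraction_of_coloring (T : diagram)
    (C : tangle_coloring T) : ratinf :=
  extfrac (NE C - NW C) (NE C - SE C).

Definition R0_monochromatic (T : diagram) : Prop :=
  forall C : tangle_coloring T, c_coloring C -> trivial_coloring C.

Definition has_coloring_fraction (T : diagram) (r : ratinf) : Prop :=
  exists C : tangle_coloring T, d_coloring C /\ fraction_of_coloring C = r.

(* Main.v *)
Require Import Defs.
From mathcomp Require Import all_boot all_order all_algebra.
From mathcomp Require Import zify.

Set Implicit Arguments.
Unset Strict Implicit.
Unset Printing Implicit Defensive.

Import GRing.Theory.

Local Open Scope ring_scope.

(** The reason is a comparison of two facts about integer colorings.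

    Suppose the closure N(T + U) is split (the unlink is).  Color one part of
    the split diagram by 0 and the other by 1.  Isotopies transport colorings,
    and a coloring that is not monochrome cannot become monochrome, so N(T + U)
    has a coloring that is not monochrome (isotopic_equivalent,
    split_link_coloring).  It restricts to colorings of T and of U
    (coloring_numerator_sum).

    A rational tangle U is rigid: every coloring of U has ends in the ratio
    given by the fraction of U, and is monochrome as soon as its four ends
    agree.  Both follow by induction on the construction of U
    (rational_coloring).

    If the restriction to T had equal ends, it would be trivial because T is
    monochromatic; then the ends of U agree too, U is monochrome by rigidity,
    and so is the whole coloring, a contradiction.  Hence T receives a
    d-coloring.  The ends of U are those of T reflected left to right, which
    negates NE - NW and, by the relation NW + SE = NE + SW, preserves NE - SE;
    so the coloring fraction of T is the opposite of the fraction of U. *)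

(** * Colorings of a slice *)

(** The labels that a piece acts on, without the strands on its sides. *)
Inductive piece_coloring : piece -> seq int -> seq int -> Prop :=
| piece_cap x : piece_coloring Cap [::] [:: x; x]
| piece_cup x : piece_coloring Cup [:: x; x] [::]
| piece_cross_true x y z : x + z = 2 * y ->
    piece_coloring (Cross true) [:: y; x] [:: z; y]
| piece_cross_false x y z : x + z = 2 * y ->
    piece_coloring (Cross false) [:: x; y] [:: y; z].

Lemma slice_coloringP k i u v :
  slice_coloring (k, i) u v <->
  exists l w w' r, [/\ size l = i, u = l ++ w ++ r, v = l ++ w' ++ r
    & piece_coloring k w w'].
Proof.
split.
  move E: (k, i) => s H; case: H E => l r.
  - by move=> x [-> ->]; exists l, [::], [:: x; x], r; split=> //; constructor.
  - by move=> x [-> ->]; exists l, [:: x; x], [::], r; split=> //; constructor.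
  - move=> x y z e [-> ->]; exists l, [:: y; x], [:: z; y], r.
    by split=> //; constructor.
  - move=> x y z e [-> ->]; exists l, [:: x; y], [:: y; z], r.
    by split=> //; constructor.
case=> l [w [w' [r [<- -> -> H]]]].
by case: H => [x|x|x y z e|x y z e]; constructor.
Qed.

Lemma piece_coloring_size k w w' : piece_coloring k w w' ->
  size w = arity_in k /\ size w' = arity_out k.
Proof. by case. Qed.

Lemma cat_eq_cat_le (T : Type) (s1 s2 t1 t2 : seq T) :
  (size s1 <= size t1)%N -> s1 ++ s2 = t1 ++ t2 ->
  exists2 t, t1 = s1 ++ t & s2 = t ++ t2.
Proof.
move=> e E; exists (drop (size s1) t1).
  have := congr1 (take (size s1)) E; rewrite take_size_cat // take_cat.
  case: ltnP => h; first by move=> {1}->; rewrite cat_take_drop.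
  have -> : size s1 = size t1 by lia.
  by rewrite subnn take0 cats0 drop_size cats0.
have := congr1 (drop (size s1)) E; rewrite drop_size_cat // drop_cat.
case: ltnP => h //.
have -> : size s1 = size t1 by lia.
by rewrite subnn drop0 drop_size.
Qed.

Lemma slice_coloring_left k i l u w :
  slice_coloring (k, (size l + i)%N) (l ++ u) w <->
  exists2 v, w = l ++ v & slice_coloring (k, i) u v.
Proof.
split.
  move/slice_coloringP=> [l' [a [a' [r [sl E -> H]]]]].
  have [|t El Eu] := cat_eq_cat_le _ E; first by rewrite sl leq_addr.
  exists (t ++ a' ++ r); first by rewrite El -catA.
  apply/slice_coloringP; exists t, a, a', r; split=> //.
  by move: sl; rewrite El size_cat; lia.
case=> v -> /slice_coloringP [l' [a [a' [r [sl -> -> H]]]]].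
apply/slice_coloringP; exists (l ++ l'), a, a', r.
by split; rewrite ?size_cat ?sl ?catA.
Qed.

Lemma slice_coloring_right k i u r w : (i + arity_in k <= size u)%N ->
  slice_coloring (k, i) (u ++ r) w ->
  exists2 v, w = v ++ r & slice_coloring (k, i) u v.
Proof.
move=> le /slice_coloringP [l' [a [a' [r' [sl E -> H]]]]].
have [sa _] := piece_coloring_size H.
rewrite catA in E.
have [|t Eu Er] := cat_eq_cat_le _ (esym E); first by rewrite size_cat sl sa.
exists (l' ++ a' ++ t); first by rewrite Er !catA.
by apply/slice_coloringP; exists l', a, a', t; rewrite Eu -catA.
Qed.

Lemma slice_coloring_size k i u v : slice_coloring (k, i) u v ->
  (i + arity_in k <= size u)%N /\ size v = next_width (size u) (k, i).
Proof.
move/slice_coloringP=> [l [a [a' [r [<- -> -> H]]]]].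
have [sa sa'] := piece_coloring_size H.
by rewrite /next_width !size_cat sa sa' /=; lia.
Qed.

(** * Concatenation and juxtaposition of diagrams *)

Lemma wf_cat m n D1 D2 : wf m n (D1 ++ D2) ->
  exists2 k, wf m k D1 & wf k n D2.
Proof.
elim: D1 m => [|s D1 IH] m /=; first by exists m.
by case/andP=> -> /IH [k h1 h2]; exists k.
Qed.

Lemma cat_wf m k n D1 D2 : wf m k D1 -> wf k n D2 -> wf m n (D1 ++ D2).
Proof.
elim: D1 m => [|s D1 IH] m /=; first by move/eqP->.
by case/andP=> -> /IH h /h.
Qed.

Lemma wf_inj m n n' D : wf m n D -> wf m n' D -> n = n'.
Proof.
elim: D m => [|s D IH] m /=; first by move=> /eqP <- /eqP.
by move=> /andP[_ h] /andP[_]; apply: IH h.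
Qed.

Lemma coloring_cat D1 D2 u C : coloring (D1 ++ D2) u C <->
  exists C1 C2, [/\ C = C1 ++ C2, coloring D1 u C1
    & coloring D2 (last u C1) C2].
Proof.
elim: D1 u C => [|s D1 IH] u C /=.
  split; first by move=> h; exists [::], C.
  by case=> [] [|? ?] [C2 [-> //]].
case: C => [|v C]; first by split=> // -[[|? ?] [C2 []]].
split.
  by case=> h /IH [C1 [C2 [-> h1 h2]]]; exists (v :: C1), C2.
case=> [] [|v' C1] [C2 [//= [-> ->] [h h1] h2]].
by split=> //; apply/IH; exists C1, C2.
Qed.

Lemma coloring_size m n D u C : wf m n D -> size u = m -> coloring D u C ->
  size (last u C) = n.
Proof.
elim: D m u C => [|[k i] D IH] m u [|v C] //=; first by move=> /eqP <-.
case/andP=> _ h su [/slice_coloring_size [_ sv] hC].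
by apply: IH h _ hC; rewrite sv su.
Qed.

Lemma coloring_shift l D u C :
  coloring (shift (size l) D) (l ++ u) C <->
  exists2 C', C = [seq l ++ v | v <- C'] & coloring D u C'.
Proof.
elim: D u C => [|[k i] D IH] u C /=.
  case: C => [|v C]; split=> //; first by exists [::].
  by case=> [] [|? ?].
case: C => [|v C]; first by split=> // -[[|? ?]].
rewrite slice_coloring_left; split.
  case=> [[v' -> hv] /IH [C' -> hC]].
  by exists (v' :: C').
case=> [] [|v' C'] // [-> ->] [hv hC]; split; first by exists v'.
by apply/IH; exists C'.
Qed.

Lemma coloring_right m n D u r C : wf m n D -> size u = m ->
  coloring D (u ++ r) C ->
  exists2 C', C = [seq v ++ r | v <- C'] & coloring D u C'.
Proof.
elim: D m u C => [|[k i] D IH] m u [|v C] //=; first by exists [::].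
case/andP=> le h su [/slice_coloring_right []]; first by rewrite su.
move=> v' -> hv; have [_ sv] := slice_coloring_size hv.
rewrite su in sv.
by move=> /(IH _ _ _ h sv) [C' -> hC]; exists (v' :: C').
Qed.

Definition monochrome (x : int) (C : seq (seq int)) := all (all (pred1 x)) C.

(** * Comparing the colorings of two diagrams *)

(** Equal ends allow the replacement inside a larger diagram.  The last clause
    is the contrapositive of what is needed: a coloring that is not monochrome
    does not become monochrome. *)
Definition simulates (D D' : diagram) (u : seq int) : Prop :=
  forall C, coloring D u C ->
  exists C', [/\ coloring D' u C', last u C' = last u C
    & forall x, monochrome x (u :: C') -> monochrome x (u :: C)].

Lemma simulates_shift l D D' u : simulates D D' u ->
  simulates (shift (size l) D) (shift (size l) D') (l ++ u).
Proof.
move=> S C /coloring_shift [C1 -> /S [C2 [h2 E cst]]].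
exists [seq l ++ v | v <- C2]; split.
- by apply/coloring_shift; exists C2.
- by rewrite !last_map E.
move=> x; rewrite /monochrome /= !all_cat -andbA => /and3P[cl cu c2].
rewrite cl cu /= all_map; have /cst : monochrome x (u :: C2).
  rewrite /monochrome /= cu; apply/allP=> v hv.
  by have /(_ _ (map_f _ hv)) := allP c2; rewrite all_cat => /andP[].
case/andP=> _ /allP c1; apply/allP=> v /c1 /=.
by rewrite all_cat cl.
Qed.

(** * Slices in the leftmost positions *)

Lemma slice_coloring0 k u v : slice_coloring (k, 0%N) u v <->
  exists w w' r, [/\ u = w ++ r, v = w' ++ r & piece_coloring k w w'].
Proof.
rewrite slice_coloringP; split.
  by case=> [] [|? ?] [w [w' [r [// _ -> -> H]]]]; exists w, w', r.
by case=> w [w' [r [-> -> H]]]; exists [::], w, w', r.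
Qed.

Lemma slice_coloringS k i x u v : slice_coloring (k, i.+1) (x :: u) v <->
  exists2 v', v = x :: v' & slice_coloring (k, i) u v'.
Proof. exact: (slice_coloring_left k i [:: x] u v). Qed.

Lemma capP u v : slice_coloring (Cap, 0%N) u v <-> exists x, v = x :: x :: u.
Proof.
rewrite slice_coloring0; split.
  case=> w [w' [r [-> -> H]]].
  by move E: Cap H => k H; case: H E => // x _; exists x.
by case=> x ->; exists [::], [:: x; x], u; split=> //; constructor.
Qed.

Lemma cupP u v : slice_coloring (Cup, 0%N) u v <-> exists x, u = x :: x :: v.
Proof.
rewrite slice_coloring0; split.
  case=> w [w' [r [-> -> H]]].
  by move E: Cup H => k H; case: H E => // x _; exists x.
by case=> x ->; exists [:: x; x], [::], v; split=> //; constructor.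
Qed.

(** The lower labels at a crossing with upper labels x, y: the overarc keeps its
    label, and the other one is reflected in it. *)
Definition crossed (b : bool) (x y : int) :=
  if b then [:: 2 * x - y; x] else [:: y; 2 * y - x].

Lemma crossP b u v : slice_coloring (Cross b, 0%N) u v <->
  exists x y r, u = x :: y :: r /\ v = crossed b x y ++ r.
Proof.
rewrite slice_coloring0; split.
  case=> w [w' [r [-> -> H]]].
  move E: (Cross b) H => k H; case: H E => // x y z e [->].
    exists y, x, r; split=> //=; congr [:: _, _ & _]; lia.
  exists x, y, r; split=> //=; congr [:: _, _ & _]; lia.
case=> x [y [r [-> ->]]]; exists [:: x; y], (crossed b x y), r; split=> //.
by case: b; constructor; lia.
Qed.

Lemma crossed_monochrome b a x y :
  all (pred1 a) (crossed b x y) = (x == a) && (y == a).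
Proof. by case: b => /=; lia. Qed.

Lemma coloring1 s u C : coloring [:: s] u C <->
  exists2 v, C = [:: v] & slice_coloring s u v.
Proof.
split; last by case=> v ->.
by case: C => [//|v [|? ?]] [h //] _; exists v.
Qed.

Lemma coloring2 s1 s2 u C : coloring [:: s1; s2] u C <->
  exists v w, [/\ C = [:: v; w], slice_coloring s1 u v & slice_coloring s2 v w].
Proof.
split; last by case=> v [w [-> ? ?]].
case: C => [|v [|w [|? ?]]] /=; [by []|by case|idtac|by case=> _ []].
by case=> h1 [h2 _]; exists v, w.
Qed.

Lemma coloring_nil u C : coloring [::] u C <-> C = [::].
Proof. by case: C. Qed.

(** * Invariance under the moves *)

Definition equivalent D D' u := simulates D D' u /\ simulates D' D u.

(** The moves are stated at every position; this reduces each of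
    them to its leftmost position, the strands to its left being inert.  The
    shifted diagrams are given up to an equation because their positions are
    usually not syntactically of the form i + _. *)
Lemma equivalent_shift i L R L' R' m n u : L' = shift i L -> R' = shift i R ->
  L <> [::] -> wf m n L' -> size u = m ->
  (forall u', (size u' = m - i)%N -> equivalent L R u') ->
  equivalent L' R' u.
Proof.
move=> -> -> + + su H.
case: L H => [//|[k j] L] H _ /= /andP[le _].
have si : size (take i u) = i by rewrite size_take_min; lia.
have {H} [H1 H2] : equivalent ((k, j) :: L) R (drop i u).
  by apply: H; rewrite size_drop su.
have := simulates_shift (l := take i u) H1.
have := simulates_shift (l := take i u) H2.
by rewrite si cat_take_drop; split.
Qed.

Lemma zigzag_left_equivalent x u :
  equivalent [:: (Cap, 0%N); (Cup, 1%N)] [::] (x :: u).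
Proof.
split=> C.
  case/coloring2=> v [w [-> /capP [y ->]]].
  case/slice_coloringS=> w' -> /cupP [_ [<- <- <-]].
  by exists [::]; split=> // a; rewrite /monochrome /=; lia.
move/coloring_nil=> ->; exists [:: [:: x, x, x & u]; x :: u]; split=> //.
- apply/coloring2; do 2 eexists; split; [by []|by apply/capP; exists x|].
  by apply/slice_coloringS; exists u => //; apply/cupP; exists x.
- by move=> a; rewrite /monochrome /=; lia.
Qed.

Lemma zigzag_right_equivalent x u :
  equivalent [:: (Cap, 1%N); (Cup, 0%N)] [::] (x :: u).
Proof.
split=> C.
  case/coloring2=> v [w [-> /slice_coloringS [w' -> /capP [y ->]]]].
  case/cupP=> _ [<- <- <-].
  by exists [::]; split=> // a; rewrite /monochrome /=; lia.
move/coloring_nil=> ->; exists [:: [:: x, x, x & u]; x :: u]; split=> //.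
- apply/coloring2; do 2 eexists; split; [by []| |by apply/cupP; exists x].
  by apply/slice_coloringS; eexists; [|apply/capP; exists x].
- by move=> a; rewrite /monochrome /=; lia.
Qed.

Lemma crossE b x y u v : slice_coloring (Cross b, 0%N) (x :: y :: u) v <->
  v = crossed b x y ++ u.
Proof.
rewrite crossP; split; first by case=> x' [y' [r [[-> -> ->] ->]]].
by move=> ->; exists x, y, u.
Qed.

Ltac list_eq := rewrite /=; repeat (congr (_ :: _); try lia).

(** On both sides the strand created by the maximum is free; its labels on the
    two sides are exchanged by the reflection in x when it passes under the
    strand labeled x, and agree when it passes over. *)
Lemma slide_cap_equivalent b x u :
  equivalent [:: (Cap, 0%N); (Cross b, 1%N)]
             [:: (Cap, 1%N); (Cross (~~ b), 0%N)] (x :: u).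
Proof.
split=> C /coloring2 [v [w [->]]].
  move=> /capP [a ->] /slice_coloringS [w' -> /crossE ->].
  pose c := if b then a else 2 * x - a.
  exists [:: [:: x, c, c & u]; crossed (~~ b) x c ++ c :: u]; split.
  - rewrite coloring2; do 2 eexists; split; first by [].
      by apply/slice_coloringS; eexists; [|apply/capP; exists c].
    by apply/crossE.
  - by rewrite /c; case: (b); list_eq.
  - by move=> z; rewrite /c /monochrome; case: (b) => /=; lia.
move=> /slice_coloringS [w' -> /capP [a ->]] /crossE ->.
pose c := if b then a else 2 * x - a.
exists [:: [:: c, c, x & u]; c :: crossed b c x ++ u]; split.
- rewrite coloring2; do 2 eexists; split; first by [].
    by apply/capP; exists c.
  by apply/slice_coloringS; eexists; [|apply/crossE].
- by rewrite /c; case: (b); list_eq.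
- by move=> z; rewrite /c /monochrome; case: (b) => /=; lia.
Qed.

(** The minimum imposes one linear condition, which is the same on both sides
    and expresses z in terms of x and y. *)
Lemma slide_cup_equivalent b x y z u :
  equivalent [:: (Cross b, 0%N); (Cup, 1%N)]
             [:: (Cross (~~ b), 1%N); (Cup, 0%N)] (x :: y :: z :: u).
Proof.
split=> C /coloring2 [v [w [->]]].
  move=> /crossE -> h.
  exists [:: x :: crossed (~~ b) y z ++ u; w].
  have {h} [h1 h2] : z = (if b then x else 2 * y - x) /\
      w = (if b then 2 * x - y else y) :: u.
    by case: b h => /slice_coloringS [w' -> /cupP [d [<- -> ->]]].
  split=> //.
  - apply/coloring2; do 2 eexists; split; first by [].
      by apply/slice_coloringS; eexists; [|apply/crossE].
    apply/cupP; rewrite h1 h2; exists x.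
    by case: (b); list_eq.
  - by move=> t; rewrite h1 h2 /monochrome; case: (b) => /=; lia.
move=> /slice_coloringS [w' -> /crossE ->] h.
exists [:: crossed b x y ++ z :: u; w].
have {h} [h1 h2] : z = (if b then x else 2 * y - x) /\
    w = (if b then 2 * x - y else y) :: u.
  case: b h => /cupP [d [<- /= e <-]]; (split; first by lia); list_eq.
  
split=> //.
- apply/coloring2; do 2 eexists; split; first by [].
    by apply/crossE.
  rewrite h1 h2; case: (b);
    by apply/slice_coloringS; eexists; [|apply/cupP; eexists].
- by move=> t; rewrite h1 h2 /monochrome; case: (b) => /=; lia.
Qed.

Lemma R1_cap_equivalent b u :
  equivalent [:: (Cap, 0%N); (Cross b, 0%N)] [:: (Cap, 0%N)] u.
Proof.
split=> C.
  move=> /coloring2 [v [w [-> /capP [a ->] /crossE ->]]].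
  exists [:: [:: a, a & u]]; split.
  - by split=> //; apply/capP; exists a.
  - by case: (b); list_eq.
  - by move=> t; rewrite /monochrome; case: (b) => /=; lia.
case/coloring1=> v -> /capP [a ->].
exists [:: [:: a, a & u]; [:: a, a & u]]; split=> //.
- apply/coloring2; do 2 eexists; split; first by [].
    by apply/capP; exists a.
  by apply/crossE; case: (b); list_eq.
- by move=> t; rewrite /monochrome /=; lia.
Qed.

Lemma R1_cup_equivalent b u :
  equivalent [:: (Cross b, 0%N); (Cup, 0%N)] [:: (Cup, 0%N)] u.
Proof.
split=> C.
  move=> /coloring2 [v [w [-> /crossP [x [y [r [-> ->]]]] h]]].
  exists [:: r].
  have [-> ->] : y = x /\ w = r.
    by case: b h => /cupP [d /= [e1 e2 ->]]; split=> //; lia.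
  split=> //.
  - by split=> //; apply/cupP; exists x.
  - by move=> t; rewrite /monochrome; case: (b) => /=; lia.
case/coloring1=> v -> /cupP [a ->].
exists [:: [:: a, a & v]; v]; split=> //.
- apply/coloring2; do 2 eexists; split; first by [].
    by apply/crossE; case: (b); list_eq.
  by apply/cupP; exists a.
- by move=> t; rewrite /monochrome /=; lia.
Qed.

Lemma R2_equivalent b x y u :
  equivalent [:: (Cross b, 0%N); (Cross (~~ b), 0%N)] [::] (x :: y :: u).
Proof.
split=> C.
  move=> /coloring2 [v [w [-> /crossE -> h]]].
  have {h} -> : w = x :: y :: u.
    by case: b h => /crossE ->; list_eq.
  exists [::]; split=> // t; rewrite /monochrome; case: (b) => /=; lia.
move/coloring_nil => ->.
exists [:: crossed b x y ++ u; x :: y :: u]; split=> //.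
- apply/coloring2; do 2 eexists; split; first by [].
    by apply/crossE.
  by case: (b); apply/crossE; list_eq.
- by move=> t; rewrite /monochrome /=; lia.
Qed.

Lemma coloring3 s1 s2 s3 u C : coloring [:: s1; s2; s3] u C <->
  exists v w z, [/\ C = [:: v; w; z], slice_coloring s1 u v,
    slice_coloring s2 v w & slice_coloring s3 w z].
Proof.
split; last by case=> v [w [z [-> ? ? ?]]].
case: C => [[]|v C [h1 /coloring2 [w [z [-> h2 h3]]]]].
by exists v, w, z.
Qed.

Lemma cross1E b t x y u v : slice_coloring (Cross b, 1%N) (t :: x :: y :: u) v
  <-> v = t :: crossed b x y ++ u.
Proof.
by rewrite slice_coloringS; split=> [[v' -> /crossE ->]|->] //;
   exists (crossed b x y ++ u) => //; apply/crossE.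
Qed.

(** The upper labels determine each side completely; that both sides end in
    the same labels is the self-distributivity of the quandle. *)
Lemma R3_equivalent b x y z u :
  equivalent [:: (Cross b, 0%N); (Cross b, 1%N); (Cross b, 0%N)]
             [:: (Cross b, 1%N); (Cross b, 0%N); (Cross b, 1%N)]
    (x :: y :: z :: u).
Proof.
(* The unique colorings of the two sides. *)
pose L := if b
  then [:: [:: 2 * x - y, x, z & u]; [:: 2 * x - y, 2 * x - z, x & u];
           [:: 2 * x - 2 * y + z, 2 * x - y, x & u]]
  else [:: [:: y, 2 * y - x, z & u]; [:: y, z, 2 * z - 2 * y + x & u];
           [:: z, 2 * z - y, 2 * z - 2 * y + x & u]].
pose R := if b
  then [:: [:: x, 2 * y - z, y & u]; [:: 2 * x - 2 * y + z, x, y & u];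
           [:: 2 * x - 2 * y + z, 2 * x - y, x & u]]
  else [:: [:: x, z, 2 * z - y & u]; [:: z, 2 * z - x, 2 * z - y & u];
           [:: z, 2 * z - y, 2 * z - 2 * y + x & u]].
have hL C : coloring [:: (Cross b, 0%N); (Cross b, 1%N); (Cross b, 0%N)]
    (x :: y :: z :: u) C <-> C = L.
  rewrite coloring3 /L; case: (b); split.
  - by case=> v [w [t [-> /crossE -> /cross1E -> /crossE ->]]]; list_eq.
  - move=> ->; do 3 eexists.
    by split; first (by []);
      [apply/crossE|apply/cross1E|apply/crossE];
      list_eq.
  - by case=> v [w [t [-> /crossE -> /cross1E -> /crossE ->]]]; list_eq.
  - move=> ->; do 3 eexists.
    by split; first (by []);
      [apply/crossE|apply/cross1E|apply/crossE];
      list_eq.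
have hR C : coloring [:: (Cross b, 1%N); (Cross b, 0%N); (Cross b, 1%N)]
    (x :: y :: z :: u) C <-> C = R.
  rewrite coloring3 /R; case: (b); split.
  - by case=> v [w [t [-> /cross1E -> /crossE -> /cross1E ->]]]; list_eq.
  - move=> ->; do 3 eexists.
    by split; first (by []);
      [apply/cross1E|apply/crossE|apply/cross1E];
      list_eq.
  - by case=> v [w [t [-> /cross1E -> /crossE -> /cross1E ->]]]; list_eq.
  - move=> ->; do 3 eexists.
    by split; first (by []);
      [apply/cross1E|apply/crossE|apply/cross1E];
      list_eq.
split=> C.
  move/hL => ->; exists R; split; first by apply/hR.
    by rewrite /L /R; case: (b).
  by move=> t; rewrite /L /R /monochrome; case: (b) => /=; lia.
move/hR => ->; exists L; split; first by apply/hL.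
  by rewrite /L /R; case: (b).
by move=> t; rewrite /L /R /monochrome; case: (b) => /=; lia.
Qed.

(** The two pieces act on disjoint groups of strands. *)
Lemma exchange_equivalent k k' j u :
  equivalent [:: (k, 0%N); (k', arity_out k + j)%N]
             [:: (k', arity_in k + j)%N; (k, 0%N)] u.
Proof.
split=> C /coloring2 [v [w [->]]].
  move=> /slice_coloring0 [a [a' [t [-> -> ha]]]].
  have [sa sa'] := piece_coloring_size ha.
  rewrite -sa' => /slice_coloring_left [w' ->].
  move=> /slice_coloringP [l [c [c' [r [sl -> -> hc]]]]].
  exists [:: a ++ l ++ c' ++ r; a' ++ l ++ c' ++ r]; split=> //.
    apply/coloring2; do 2 eexists; split; first by [].
      rewrite -sa; apply/slice_coloring_left; eexists; first by [].
      by apply/slice_coloringP; exists l, c, c', r.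
    by apply/slice_coloring0; exists a, a', (l ++ c' ++ r).
  move=> x; rewrite /monochrome /= !all_cat.
  by do ![case: (all _ _) => //=].
move=> /slice_coloringP [l0 [c [c' [r [sl -> -> hc]]]]].
move=> /slice_coloring0 [a [a' [t [E -> ha]]]].
have [sa sa'] := piece_coloring_size ha.
have [|l El Et] := cat_eq_cat_le _ (esym E); first by rewrite sl sa leq_addr.
have {}sl : size l = j by move: sl; rewrite El size_cat sa; lia.
exists [:: a' ++ l ++ c ++ r; a' ++ l ++ c' ++ r]; split.
- rewrite El -catA; apply/coloring2; do 2 eexists; split; first by [].
    by apply/slice_coloring0; exists a, a', (l ++ c ++ r).
  rewrite -sa'; apply/slice_coloring_left; eexists; first by [].
  by apply/slice_coloringP; exists l, c, c', r.
- by rewrite /= Et.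
move=> x; rewrite Et El /monochrome /= !all_cat.
by do ![case: (all _ _) => //=].
Qed.

Lemma move_equivalent L R k m n u : move L R -> wf k m L -> wf k n R ->
  size u = k -> equivalent L R u.
Proof.
case=> {L R}.
- move=> a a' i j hL hR su.
  apply: (@equivalent_shift i [:: (a, 0); (a', arity_out a + j)]%N
     [:: (a', arity_in a + j); (a, 0)]%N
    _ _ k m u _ _ _ hL su);
    rewrite /shift /= ?addn0 ?addn1 ?addnA // => u' _;
    exact: exchange_equivalent.
- move=> i hL hR su.
  apply: (@equivalent_shift i [:: (Cap, 0); (Cup, 1)]%N [::]
    _ _ k m u _ _ _ hL su);
    rewrite /shift /= ?addn0 ?addn1 ?addnA // => -[|x u'] su';
    last exact: zigzag_left_equivalent;
  by move: hL su' => /=; rewrite /next_width /=; lia.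
- move=> i hL hR su.
  apply: (@equivalent_shift i [:: (Cap, 1); (Cup, 0)]%N [::]
    _ _ k m u _ _ _ hL su);
    rewrite /shift /= ?addn0 ?addn1 ?addnA // => -[|x u'] su';
    last exact: zigzag_right_equivalent;
  by move: hL su' => /=; rewrite /next_width /=; lia.
- move=> b i hL hR su.
  apply: (@equivalent_shift i [:: (Cap, 0); (Cross b, 1)]%N
    [:: (Cap, 1); (Cross (~~ b), 0)]%N
    _ _ k m u _ _ _ hL su);
    rewrite /shift /= ?addn0 ?addn1 ?addnA // => -[|x u'] su';
    last exact: slide_cap_equivalent;
  by move: hL su' => /=; rewrite /next_width /=; lia.
- move=> b i hL hR su.
  apply: (@equivalent_shift i [:: (Cross b, 0); (Cup, 1)]%N
    [:: (Cross (~~ b), 1); (Cup, 0)]%N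
    _ _ k m u _ _ _ hL su);
    rewrite /shift /= ?addn0 ?addn1 ?addnA // => -[|x [|y [|z u']]] su';
    last exact: slide_cup_equivalent;
  by move: hL su' => /=; rewrite /next_width /=; lia.
- move=> b i hL hR su.
  apply: (@equivalent_shift i [:: (Cap, 0); (Cross b, 0)]%N
    [:: (Cap, 0)]%N
    _ _ k m u _ _ _ hL su);
    rewrite /shift /= ?addn0 ?addn1 ?addnA // => u' _; exact: R1_cap_equivalent.
- move=> b i hL hR su.
  apply: (@equivalent_shift i [:: (Cross b, 0); (Cup, 0)]%N
    [:: (Cup, 0)]%N
    _ _ k m u _ _ _ hL su);
    rewrite /shift /= ?addn0 ?addn1 ?addnA // => u' _; exact: R1_cup_equivalent.
- move=> b i hL hR su.
  apply: (@equivalent_shift i [:: (Cross b, 0); (Cross (~~ b), 0)]%N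
    [::]%N
    _ _ k m u _ _ _ hL su);
    rewrite /shift /= ?addn0 ?addn1 ?addnA // => -[|x [|y u']] su';
    last exact: R2_equivalent;
  by move: hL su' => /=; rewrite /next_width /=; lia.
- move=> b i hL hR su.
  apply: (@equivalent_shift i [:: (Cross b, 0); (Cross b, 1); (Cross b, 0)]%N
    [:: (Cross b, 1); (Cross b, 0); (Cross b, 1)]%N
    _ _ k m u _ _ _ hL su);
    rewrite /shift /= ?addn0 ?addn1 ?addnA // => -[|x [|y [|z u']]] su';
    last exact: R3_equivalent;
  by move: hL su' => /=; rewrite /next_width /=; lia.
Qed.

(** * Invariance under isotopy *)

Lemma simulates_trans D1 D2 D3 u :
  simulates D1 D2 u -> simulates D2 D3 u -> simulates D1 D3 u.
Proof.
move=> S12 S23 C /S12 [C2 [/S23 [C3 [h3 <- c32]] <- c21]].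
by exists C3; split=> // x /c32 /c21.
Qed.

Lemma simulates_context D1 D2 L R u :
  (forall C, coloring D1 u C -> simulates L R (last u C)) ->
  simulates (D1 ++ L ++ D2) (D1 ++ R ++ D2) u.
Proof.
move=> S C /coloring_cat [C1 [C' [-> h1]]].
move=> /coloring_cat [CL [C2 [-> hL h2]]].
have [CR [hR E c]] := S _ h1 _ hL.
exists (C1 ++ CR ++ C2); split.
- apply/coloring_cat; exists C1, (CR ++ C2); split=> //.
  by apply/coloring_cat; exists CR, C2; split; rewrite ?E.
- by rewrite !last_cat E.
move=> x. rewrite -!cat_cons. rewrite /monochrome !all_cat.
case/and3P=> h1x hRx ->; rewrite h1x andbT /=.
have /c : monochrome x (last u C1 :: CR).
  by rewrite /monochrome /= hRx andbT; apply: (allP h1x); apply: mem_last.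
by case/andP.
Qed.

(** Well-formedness is carried along in the induction: it is what bounds the
    number of strands at the place where a move is applied. *)
Lemma isotopic_equivalent m n D D' : isotopic m n D D' ->
  wf m n D = wf m n D' /\
  (wf m n D -> forall u, size u = m -> equivalent D D' u).
Proof.
elim=> {D D'}.
- move=> _ _ [D1 D2 L R mv hL hR]; rewrite hL hR; split=> // _ u su.
  have [k h1 /wf_cat [k1 hL1 _]] := wf_cat hL.
  have [k' h1' /wf_cat [k2 hR1 _]] := wf_cat hR.
  rewrite -(wf_inj h1 h1') in hR1.
  have e C : coloring D1 u C -> equivalent L R (last u C).
    by move=> hC; apply: move_equivalent mv hL1 hR1 (coloring_size h1 su hC).
  by split; apply: simulates_context => C /e [].
- by move=> D; split=> // _ u _; split=> C hC; exists C.
- move=> D D' _ [E H]; split=> // h u su; rewrite -E in h.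
  by have [] := H h u su.
- move=> D1 D2 D3 _ [E1 H1] _ [E2 H2]; split; first by rewrite E1.
  move=> h u su; have [S12 S21] := H1 h u su.
  rewrite E1 in h; have [S23 S32] := H2 h u su.
  by split; [apply: simulates_trans S12 S23|apply: simulates_trans S32 S21].
Qed.

(** * Colorings of sums and closures *)

Lemma monochrome_cat z C1 C2 :
  monochrome z (C1 ++ C2) = monochrome z C1 && monochrome z C2.
Proof. exact: all_cat. Qed.

Lemma wf_right r m n D : wf m n D -> wf (m + r) (n + r) D.
Proof.
elim: D m => [|[k i] D IH] m /=; first by move/eqP->.
case/andP=> le /IH; have -> : (next_width m (k, i) + r =
  next_width (m + r) (k, i))%N by rewrite /next_width /=; lia.
by move=> ->; rewrite andbT; lia.
Qed.

Lemma wf_shift l m n D : wf m n D -> wf (l + m) (l + n) (shift l D).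
Proof.
elim: D m => [|[k i] D IH] m /=; first by move/eqP->.
case/andP=> le /IH; have -> : (l + next_width m (k, i) =
  next_width (l + m) (k, l + i))%N by rewrite /next_width /=; lia.
by move=> ->; rewrite andbT; lia.
Qed.

Lemma wf_tangle_sum T U : wf 2 2 T -> wf 2 2 U -> wf 2 2 (tangle_sum T U).
Proof.
move=> /(wf_right 2) hT /(wf_shift 2) hU.
by apply: cat_wf hT _; apply: cat_wf hU _.
Qed.

Lemma coloring_size2 D a b C : wf 2 2 D -> coloring D [:: a; b] C ->
  exists c d, last [:: a; b] C = [:: c; d].
Proof.
move=> h /(coloring_size (u := [:: a; b]) h erefl).
by case: (last _ C) => [|c [|d [|? ?]]] // _; exists c, d.
Qed.

(** The labels x and y are those of the two strands along which T and U are
    glued. *)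
Lemma coloring_tangle_sum T U a b C : wf 2 2 T -> wf 2 2 U ->
  coloring (tangle_sum T U) [:: a; b] C ->
  exists x c y d CT CU,
  [/\ coloring T [:: a; x] CT /\ last [:: a; x] CT = [:: c; y],
      coloring U [:: x; b] CU /\ last [:: x; b] CU = [:: y; d],
      last [:: a; b] C = [:: c; d]
    & forall z, monochrome z ([:: a; x] :: CT) ->
        monochrome z ([:: x; b] :: CU) -> monochrome z C].
Proof.
move=> wT wU; case: C => [[]|v C [/slice_coloringS [_ -> /capP [x ->]]]].
case/coloring_cat=> C1 [C' [->]].
move/(coloring_right (u := [:: a; x]) (r := [:: x; b]) wT erefl).
case=> // CT -> hT; rewrite (last_map (fun v => v ++ [:: x; b]) _ [:: a; x]).
have [c [y lT]] := coloring_size2 wT hT; rewrite lT.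
case/coloring_cat=> C1' [C2 [-> /(coloring_shift [:: c; y])]].
case=> CU -> hU; rewrite (last_map (cat [:: c; y]) _ [:: x; b]).
have [y' [d lU]] := coloring_size2 wU hU; rewrite lU.
case/coloring1 => w -> /slice_coloringS [w' -> /cupP [_ [<- ey <-]]].
rewrite {}ey in lU *.
exists x, c, y, d, CT, CU; split=> //; first by rewrite last_cons !last_cat.
move=> z hTz hUz.
have /and3P[ec ey _] : all (pred1 z) [:: c; y].
  by rewrite -lT; apply: (allP hTz); apply: mem_last.
have /and3P[_ ed _] : all (pred1 z) [:: y; d].
  by rewrite -lU; apply: (allP hUz); apply: mem_last.
case/andP: hTz => /and3P[ea ex _] hT'; case/andP: hUz => /and3P[_ eb _] hU'.
rewrite -cat1s !monochrome_cat /monochrome !all_map.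
rewrite /= in ea ex eb ec ey ed *.
rewrite ea ex eb ec ed /=; apply/andP; split.
  by apply: sub_all hT' => s hs; rewrite /= all_cat hs /= ex eb.
by rewrite andbT; apply: sub_all hU' => s hs /=; rewrite ec ey hs.
Qed.

Lemma coloring_numerator_sum T U C : wf 2 2 T -> wf 2 2 U ->
  coloring (numerator (tangle_sum T U)) [::] C ->
  exists a x c y CT CU,
  [/\ coloring T [:: a; x] CT /\ last [:: a; x] CT = [:: c; y],
      coloring U [:: x; a] CU /\ last [:: x; a] CU = [:: y; c]
    & forall z, monochrome z ([:: a; x] :: CT) ->
        monochrome z ([:: x; a] :: CU) -> monochrome z C].
Proof.
move=> wT wU; case: C => [[]|v C [/capP [a ->]]].
case/(coloring_cat (tangle_sum T U))=> C1 [C2 [->]].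
move/(coloring_tangle_sum wT wU).
case=> x [c [y [d [CT [CU [hT hU -> mono]]]]]].
case/coloring1=> w -> /cupP [_ [<- ed <-]]; rewrite ed in hU.
exists a, x, c, y, CT, CU; split=> // z hTz hUz.
rewrite -cat1s !monochrome_cat mono //= !andbT.
by move: hTz => /= /andP[/= /andP[-> _] _].
Qed.

(** * Colorings of rational tangles *)

(** The equation m / n = f, cleared of denominators so that it holds for
    m = n = 0: a coloring with equal ends then satisfies it as well, and no
    case is distinguished in the induction on rational tangles. *)
Definition has_slope (f : ratinf) (m n : int) : Prop :=
  if f is Some r then m%:~R = r * n%:~R else n = 0.

Lemma has_slope_inv f m n : has_slope f m n -> has_slope (ratinf_inv f) n m.
Proof.
case: f => [r|] /=; last by move=> ->; rewrite mul0r.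
case: eqVneq => [->|r0] /=; last by move=> ->; rewrite mulKf.
by rewrite mul0r => /eqP; rewrite intr_eq0 => /eqP.
Qed.

Lemma has_slope_add b f m n : has_slope f m n ->
  has_slope (ratinf_add f (pm1 b)) (if b then m + n else m - n) n.
Proof.
case: f => [r|] //= h; rewrite mulrDl -h /pm1.
by case: b; rewrite ?intrD ?mulrNz /= ?mul1r ?mulN1r.
Qed.

Lemma rational_wf U f : rational_fraction U f -> wf 2 2 U.
Proof.
elim=> {U f} [||b T f _ h|b T f _ h|T T' f _ h i] //.
- exact: wf_tangle_sum.
- exact: cat_wf h _.
- by have [<-] := isotopic_equivalent i.
Qed.

(** Adding a crossing on the east side replaces NE - NW by its sum or difference
    with NE - SE and keeps NE - SE; multiplying by one from below does the same
    with the two differences exchanged.  The ends of the larger tangle also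
    determine the labels of the strands at the new crossing, so that equal ends
    force equal ends of the smaller tangle. *)
Lemma rational_coloring U f : rational_fraction U f ->
  forall a b c d C, coloring U [:: a; b] C -> last [:: a; b] C = [:: c; d] ->
  [/\ a + d = b + c, has_slope f (b - a) (b - d)
    & forall z, monochrome z [:: [:: a; b]; [:: c; d]] -> monochrome z C].
Proof.
elim=> {U f}.
- move=> a b c d C /coloring2 [v [w [-> /cupP [x [-> -> <-]] /capP [y ->]]]].
  move=> /= [<- <-]; split=> //; first by rewrite subrr mul0r.
  by move=> z; rewrite /monochrome /=; lia.
- move=> a b c d C /coloring_nil -> /= [<- <-]; split=> //=; lia.
- move=> s T f /rational_wf wT IH a b c d C.
  move/(coloring_tangle_sum wT (_ : wf 2 2 (tangle_pm1 s))) => /(_ isT).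
  case=> x [c' [y [d' [CT [CU [[hT lT] [hU lU] -> mono]]]]]] [ec ed].
  rewrite {}ec {}ed in lT lU; have [e1 e2 e3] := IH _ _ _ _ _ hT lT.
  have [eC [ey ed]] : CU = [:: crossed s x b] /\
      (y = (if s then 2 * x - b else b) /\ d = (if s then x else 2 * b - x)).
    move: hU lU => /coloring1 [w -> /crossE ->] /=.
    by case: (s) => /= -[<- <-].
  split.
  + by move: e1 ey ed; case: (s); lia.
  + have := has_slope_add s e2.
    have -> : (if s then x - a + (x - y) else x - a - (x - y)) = b - a.
      by move: e1 ey ed; case: (s); lia.
    by have -> : x - y = b - d by move: e1 ey ed; case: (s); lia.
  move=> z hz.
  have [ez1 ez2] : x = z /\ y = z.
    by move: e1 ey ed hz; rewrite /monochrome /=; case: (s); lia.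
  have hz' : monochrome z [:: [:: a; x]; [:: c; y]].
    by move: hz; rewrite /monochrome /=; lia.
  apply: mono.
    by rewrite /monochrome /= -/(monochrome z CT) e3 // andbT; case/and3P: hz'.
  by move: hz; rewrite eC /monochrome /= crossed_monochrome; lia.
- move=> s T f /rational_wf wT IH a b c d C.
  case/coloring_cat=> CT [CU [-> hT hU]].
  have [c' [d' lT]] := coloring_size2 wT hT.
  have [e1 e2 e3] := IH _ _ _ _ _ hT lT; rewrite lT in hU.
  rewrite last_cat lT; case/coloring1: hU => w -> /crossE -> /= l.
  have [ec ed] : c = (if s then 2 * c' - d' else d') /\
                 d = (if s then c' else 2 * d' - c').
    by move: l; case: (s) => /= -[<- <-].
  split.
  + by move: e1 ec ed; case: (s); lia.
  + have := has_slope_inv (has_slope_add s (has_slope_inv e2)).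
    have -> // : (if s then b - d' + (b - a) else b - d' - (b - a)) = b - d.
    by move: e1 ec ed; case: (s); lia.
  move=> z hz; rewrite monochrome_cat e3.
    by rewrite /monochrome /= cats0 crossed_monochrome; move: e1 ec ed hz;
      rewrite /monochrome /=; case: (s); lia.
  by move: e1 ec ed hz; rewrite /monochrome /=; case: (s); lia.
- move=> T T' f /rational_wf wT IH i a b c d C' hC' lC'.
  have [_ /(_ wT [:: a; b] erefl) [_ S]] := isotopic_equivalent i.
  have [C [hC lC m]] := S _ hC'.
  have [e1 e2 e3] := IH _ _ _ _ _ hC (etrans lC lC').
  split=> // z hz.
  have /m /andP[//] : monochrome z ([:: a; b] :: C).
  rewrite /monochrome /= -/(monochrome z C) e3 // andbT.
  by case/andP: hz.
Qed.

(** * Split links *)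

Lemma coloring_nseq m n D z : wf m n D ->
  exists C, [/\ coloring D (nseq m z) C, last (nseq m z) C = nseq n z
    & monochrome z C].
Proof.
elim: D m => [|[k i] D IH] m /=; first by move=> /eqP ->; exists [::].
case/andP=> le /IH [C [hC lC mC]].
exists (nseq (next_width m (k, i)) z :: C); split=> //.
  split=> //; apply/slice_coloringP.
  exists (nseq i z), (nseq (arity_in k) z), (nseq (arity_out k) z),
    (nseq (m - i - arity_in k) z).
  split; rewrite ?size_nseq //.
  - by rewrite -!nseqD; congr nseq; lia.
  - by rewrite -!nseqD; congr nseq; rewrite /next_width /=; lia.
  - by case: k {le hC lC IH} => [||[]]; constructor; lia.
by rewrite /monochrome /= -/(monochrome z C) mC all_nseq /= eqxx orbT.
Qed.

(** A nonempty diagram without ends starts with a maximum, hence has a strand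
    that carries the prescribed label. *)
Lemma closed_diagram_coloring D z : wf 0 0 D -> D <> [::] ->
  exists C, [/\ coloring D [::] C, last [::] C = [::]
    & forall x, monochrome x C -> x = z].
Proof.
case: D => [//|[k i] D] w _; have [C [hC lC mC]] := coloring_nseq z w.
exists C; split=> // x mx; case/andP: w => le _.
have [k0 i0] : k = Cap /\ i = 0%N.
  by case: k le {hC} => [||b]; rewrite /= ?addn0 ?addnS //; case: (i).
rewrite {}k0 {}i0 {le} in hC.
case: C hC lC mC mx => [[]|v C [/capP [y ->] _]] _.
by move=> /andP[/andP[/eqP <- _] _] /andP[/andP[/eqP <- _] _].
Qed.

(** Color the two parts by 0 and by 1. *)
Lemma split_link_coloring D : split_link D ->
  exists2 C, coloring D [::] C & forall x, ~~ monochrome x C.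
Proof.
case=> D1 [D2 [[w1 n1] [w2 n2] i]].
have [C1 [h1 l1 m1]] := closed_diagram_coloring 0 w1 n1.
have [C2 [h2 l2 m2]] := closed_diagram_coloring 1 w2 n2.
have [E /(_ _ [::] erefl) []] := isotopic_equivalent i.
  by rewrite E; apply: cat_wf w1 w2.
move=> _ /(_ (C1 ++ C2)) [|C [hC _ m]].
  by apply/coloring_cat; exists C1, C2; rewrite l1.
exists C => // x; apply/negP => mx.
have /m : monochrome x ([::] :: C) by [].
rewrite -cat1s !monochrome_cat => /and3P[_ /m1 -> /m2].
by [].
Qed.

Lemma closure_split_link T U :
  unlinking_closure T U \/ rational_splitting_closure T U ->
  split_link (numerator (tangle_sum T U)).
Proof.
case=> [[_ h]|[[_ h] _]] //.
by exists [:: (Cap, 0%N); (Cup, 0%N)], [:: (Cap, 0%N); (Cup, 0%N)].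
Qed.

(** * The coloring fraction of the tangle *)

Lemma trivial_coloring_monochrome T (S : tangle_coloring T) :
  trivial_coloring S -> exists x, monochrome x ([:: NW S; NE S] :: levels S).
Proof.
case=> x h; exists x; apply/allP=> u hu; apply/allP=> y hy.
by apply/eqP; apply: h hu _ hy.
Qed.

Theorem corollary5p12 (T : diagram) (p q : int) (U : diagram)
  (hT : two_string_tangle T)
  (hmono : R0_monochromatic T)
  (hpq : coprimez p q)
  (hU : rational_fraction U (extfrac p q))
  (hclosure : unlinking_closure T U \/ rational_splitting_closure T U) :
  has_coloring_fraction T (extfrac (- p) q).
Proof.
have [C hC nontrivial] := split_link_coloring (closure_split_link hclosure).
have [a [x [c [y [CT [CU [[hCT lT] [hCU lU] mono]]]]]]] :=
  coloring_numerator_sum hT.1 (rational_wf hU) hC.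
have [e slope monoU] := rational_coloring hU hCU lU.
pose S := TangleColoring hCT lT.
have dS : d_coloring S.
  move=> cS; have [z mz] := trivial_coloring_monochrome (hmono S cS).
  case: cS => /= ax ac ay.
  have az : a = z by move: mz => /andP[] /=; lia.
  have hz : monochrome z [:: [:: x; a]; [:: y; c]].
    by rewrite /monochrome /=; lia.
  have /negP := nontrivial z; apply; apply: mono mz _.
  by rewrite /monochrome /= -/(monochrome z CU) monoU // andbT; case/andP: hz.
exists S; split=> //; rewrite /fraction_of_coloring /=.
(* Here U has NW = x, NE = a and SE = c, and T has NE = x and SE = y. *)
have ac : a - c = x - y by lia.
move: slope; rewrite /extfrac ac; case: eqP => [_ /= ->|/eqP q0 /= slope].
  by rewrite eqxx.
case: eqP => [xy|/eqP xy].
  case: dS; move: slope; rewrite xy mulr0 => /eqP; rewrite intr_eq0 => /eqP ax.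
  by split=> /=; lia.
congr Some; rewrite -(opprB a x) !mulrNz slope !mulNr mulfK //.
by rewrite intr_eq0.
Qed.
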